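(* Assume Martin's axiom and the negation of the continuum hypothesis. Let $K$ be a compact Hausdorff space such that the Banach space $C(K)$ of real-valued continuous functions on $K$ with the supremum norm is nonseparable. Then the unit ball of $C(K)$ contains an uncountable $2$-equilateral set, and for some $\varepsilon>0$ the unit ball of $C(K)$ contains an uncountable $(1+\varepsilon)$-separated set.
   Context: For $r\in\mathbb{R}$, a subset $A$ of a Banach space is $r$-separated if $\|v_1-v_2\|>r$ for all distinct $v_1,v_2\in A$, and $r$-equilateral if $\|v_1-v_2\|=r$ for all distinct $v_1,v_2\in A$. *)

(* Defs.v *)
From HB Require Import structures.
From mathcomp Require Import all_boot all_order all_algebra.
From mathcomp Require Import all_classical all_reals all_analysis.
From mathcomp Require Import lra.
Set Implicit Arguments.
Unset Strict Implicit.
Unset Printing Implicit Defensive.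
Import Order.TTheory GRing.Theory Num.Theory.
Import numFieldNormedType.Exports.

Local Open Scope classical_set_scope.
Local Open Scope card_scope.

Definition card_lt (T U : Type) (A : set T) (B : set U) : Prop :=
  A #<= B /\ ~ (B #<= A).

(* The continuum is represented by the power set of nat. *)
Definition continuum_hypothesis : Prop :=
  forall A : set (set nat), ~ countable A -> A #= [set: set nat].

Section forcing.
Local Open Scope order_scope.
Context {d : Order.disp_t} {P : porderType d}.

Definition compatible (p q : P) : Prop := exists r : P, r <= p /\ r <= q.

(* Antichains in the sense of forcing: pairwise incompatible elements, not
   merely pairwise incomparable ones. *)
Definition antichain (A : set P) : Prop :=
  forall p q : P, A p -> A q -> p <> q -> ~ compatible p q.

(* Density with respect to the order, not Topological.dense. *)
Definition order_dense (D : set P) : Prop :=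
  forall p : P, exists2 q : P, D q & q <= p.

Definition order_filter (G : set P) : Prop :=
  [/\ G !=set0,
      forall p q : P, G p -> p <= q -> G q
    & forall p q : P, G p -> G q -> exists r : P, [/\ G r, r <= p & r <= q]].

End forcing.

Definition countable_chain_condition (d : Order.disp_t) (P : porderType d) :
    Prop :=
  forall A : set P, antichain A -> countable A.

Definition martin_axiom : Prop :=
  forall (d : Order.disp_t) (P : porderType d) (Ds : set (set P)),
    [set: P] !=set0 ->
    countable_chain_condition P ->
    card_lt Ds [set: set nat] ->
    (forall D : set P, Ds D -> order_dense D) ->
    exists2 G : set P, order_filter G &
      forall D : set P, Ds D -> (G `&` D) !=set0.

Definition separable (T : topologicalType) : Prop :=
  exists2 S : set T, countable S & dense S.

Local Open Scope ring_scope.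

Definition unit_ball (R : realType) (V : completeNormedModType R) : set V :=
  [set v | `|v| <= 1].
Arguments unit_ball {R} V.

Definition r_separated (R : realType) (V : completeNormedModType R) (r : R)
    (A : set V) : Prop :=
  forall v1 v2 : V, A v1 -> A v2 -> v1 <> v2 -> r < `|v1 - v2|.

Definition r_equilateral (R : realType) (V : completeNormedModType R) (r : R)
    (A : set V) : Prop :=
  forall v1 v2 : V, A v1 -> A v2 -> v1 <> v2 -> `|v1 - v2| = r.

(* C(K) with the pointwise vector space structure and the supremum norm. The
   compactness proof is a parameter of the type because without it the
   supremum may be taken over an unbounded set and need not define a norm. *)
Definition contfun (R : realType) (K : topologicalType)
  (cK : compact [set: K]) : Type := continuousType K R.

Section contfun_lmodule.
Context {R : realType} {K : topologicalType} {cK : compact [set: K]}.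
Local Notation CK := (contfun R cK).
Implicit Types f g h : CK.

HB.instance Definition _ := Choice.on CK.

Definition mkcontfun (f : K -> R) (cf : continuous f) : CK :=
  (mkcts cf : continuousType K R).

Lemma contfun_continuous f : continuous f.
Proof. exact: (@cts_fun _ _ (f : continuousType K R)). Qed.

Lemma contfunP f g : (forall x, f x = g x) -> f = g.
Proof. by move=> fg; apply/continuousEP. Qed.

Definition contfun_zero : CK := mkcontfun (fun x => @cst_continuous K R 0 x).

Lemma contfun_opp_subproof f : continuous (fun x => - f x : R).
Proof. by move=> x; apply: cvgN; exact: contfun_continuous. Qed.

Definition contfun_opp f : CK := mkcontfun (@contfun_opp_subproof f).

Lemma contfun_add_subproof f g : continuous (fun x => f x + g x : R).
Proof. by move=> x; apply: cvgD; exact: contfun_continuous. Qed.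

Definition contfun_add f g : CK := mkcontfun (@contfun_add_subproof f g).

Lemma contfun_scale_subproof (a : R) f : continuous (fun x => a * f x : R).
Proof. by move=> x; apply: cvgMr; exact: contfun_continuous. Qed.

Definition contfun_scale (a : R) f : CK :=
  mkcontfun (@contfun_scale_subproof a f).

Lemma contfun_addA : associative contfun_add.
Proof. by move=> f g h; apply: contfunP => x; exact: addrA. Qed.

Lemma contfun_addC : commutative contfun_add.
Proof. by move=> f g; apply: contfunP => x; exact: addrC. Qed.

Lemma contfun_add0 : left_id contfun_zero contfun_add.
Proof. by move=> f; apply: contfunP => x; exact: add0r. Qed.

Lemma contfun_addN : left_inverse contfun_zero contfun_opp contfun_add.
Proof. by move=> f; apply: contfunP => x; exact: addNr. Qed.

HB.instance Definition _ := GRing.isZmodule.Build CK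
  contfun_addA contfun_addC contfun_add0 contfun_addN.

Lemma contfun_scaleA (a b : R) f :
  contfun_scale a (contfun_scale b f) = contfun_scale (a * b) f.
Proof. by apply: contfunP => x; exact: mulrA. Qed.

Lemma contfun_scale1 : left_id 1 contfun_scale.
Proof. by move=> f; apply: contfunP => x; exact: mul1r. Qed.

Lemma contfun_scaleDr : right_distributive contfun_scale +%R.
Proof. by move=> a f g; apply: contfunP => x; exact: mulrDr. Qed.

Lemma contfun_scaleDl f : {morph contfun_scale^~ f : a b / a + b}.
Proof. by move=> a b; apply: contfunP => x; exact: mulrDl. Qed.

HB.instance Definition _ := GRing.Zmodule_isLmodule.Build R CK
  contfun_scaleA contfun_scale1 contfun_scaleDr contfun_scaleDl.

Lemma contfunDE f g x : (f + g) x = f x + g x. Proof. by []. Qed.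
Lemma contfunNE f x : (- f) x = - f x. Proof. by []. Qed.
Lemma contfunZE (a : R) f x : (a *: f) x = a * f x. Proof. by []. Qed.
Lemma contfun0E x : (0 : CK) x = 0. Proof. by []. Qed.

(* The supremum of the empty set is 0, so this is also right for K empty. *)
Definition sup_norm f : R := sup [set `|f x| | x in [set: K]].

Lemma contfun_has_ubound f : has_ubound [set `|f x| | x in [set: K]].
Proof.
have /compact_bounded[M [_ fM]] : compact (f @` [set: K]).
  apply: continuous_compact => //.
  by apply/continuous_subspaceT; exact: contfun_continuous.
exists (M + 1) => _ [x _ <-]; apply: (fM (M + 1)); last by exists x.
by rewrite ltrDl.
Qed.

Lemma sup_norm_ub f x : `|f x| <= sup_norm f.
Proof. by apply: ub_le_sup; [exact: contfun_has_ubound|exists x]. Qed.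

Lemma sup_norm_ge0 f : 0 <= sup_norm f.
Proof.
have [[x _]|] := pselect ([set: K] !=set0).
  exact: le_trans (sup_norm_ub f x).
move=> K0; rewrite /sup_norm (_ : [set _ | _ in _] = set0) ?sup0//.
by apply/seteqP; split=> // y [x _ _]; case: K0; exists x.
Qed.

Lemma sup_norm_le f (e : R) :
  0 <= e -> (forall x, `|f x| <= e) -> sup_norm f <= e.
Proof.
move=> e0 fe; have [[x _]|K0] := pselect ([set: K] !=set0).
  by apply: ge_sup; [exists `|f x|, x|move=> _ [y _ <-]].
rewrite /sup_norm (_ : [set _ | _ in _] = set0) ?sup0//.
by apply/seteqP; split=> // y [x _ _]; case: K0; exists x.
Qed.

Lemma sup_normD f g : sup_norm (f + g) <= sup_norm f + sup_norm g.
Proof.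
apply: sup_norm_le => [|x]; first by rewrite addr_ge0 ?sup_norm_ge0.
by rewrite contfunDE (le_trans (ler_normD _ _))// lerD ?sup_norm_ub.
Qed.

Lemma sup_normZ (a : R) f : sup_norm (a *: f) = `|a| * sup_norm f.
Proof.
have le_sup_normZ b g : sup_norm (b *: g) <= `|b| * sup_norm g.
  apply: sup_norm_le => [|x]; first by rewrite mulr_ge0 ?sup_norm_ge0.
  by rewrite contfunZE normrM ler_wpM2l ?sup_norm_ub.
apply/eqP; rewrite eq_le le_sup_normZ/=.
have [->|a0] := eqVneq a 0; first by rewrite normr0 mul0r sup_norm_ge0.
rewrite -ler_pdivlMl ?normr_gt0// -normfV.
by rewrite -{1}[f](scalerK a0) le_sup_normZ.
Qed.

Lemma sup_norm0_eq0 f : sup_norm f = 0 -> f = 0.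
Proof.
move=> f0; apply: contfunP => x; apply/eqP.
by rewrite contfun0E -normr_le0 -f0 sup_norm_ub.
Qed.

HB.instance Definition _ := Lmodule_isNormed.Build R CK
  sup_normD sup_normZ sup_norm0_eq0.

Lemma contfun_normE f : `|f| = sup_norm f. Proof. by []. Qed.

Lemma contfun_complete (F : set_system CK) :
  ProperFilter F -> cauchy F -> cvg F.
Proof.
move=> FF Fc; have /cauchy_ballP Fb := Fc.
have ev_cvg x : cvg ((fun f : CK => f x : R) @ F).
  apply/cauchy_cvgP; apply/cauchy_ballP => e e0.
  have [[A B] /= [FA FB] AB] := Fb e e0.
  exists ((fun f : CK => f x : R) @` A, (fun f : CK => f x : R) @` B).
    by split; [apply: (@filterS _ F _ A) FA|apply: (@filterS _ F _ B) FB] => f ?;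
      exists f.
  move=> [_ _] /= [[f Af <-] [g Bg <-]].
  have := AB (f, g) (conj Af Bg); rewrite -!ball_normE /= => fg.
  exact: le_lt_trans (sup_norm_ub (f - g) x) fg.
pose l x : R := lim ((fun f : CK => f x : R) @ F).
have unif (e : R) : 0 < e -> F [set f : CK | forall x, `|l x - f x| <= e].
  move=> e0; have [[A B] /= [FA FB] AB] := Fb e e0.
  apply: filterS FB => f Bf /= x.
  have cl : closed [set y : R | `|y - f x| <= e].
    have -> : [set y : R | `|y - f x| <= e] = closed_ball_ Num.norm (f x) e.
      by apply/seteqP; split=> y /=; rewrite /closed_ball_/= distrC.
    exact: closed_closed_ball_.
  apply: (@closed_cvg _ _ F FF (fun g : CK => g x : R) _ cl _ (l x)) => //.
  apply: filterS FA => g Ag /=.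
  have := AB (g, f) (conj Ag Bf); rewrite -ball_normE /= => gf.
  exact/ltW/(le_lt_trans (sup_norm_ub (g - f) x) gf).
have cl : continuous l.
  move=> x; apply/cvgrPdist_le => e e0.
  have e3 : 0 < e / 3 by rewrite divr_gt0.
  have /filter_ex [f lf] := unif _ e3.
  have /cvgrPdist_le /(_ _ e3) := @contfun_continuous f x.
  apply: filterS => y fxy.
  have lfx := lf x; have lfy := lf y; rewrite distrC in lfy.
  have := ler_distD (f x) (l x) (l y); have := ler_distD (f y) (f x) (l y).
  by move: lfx fxy lfy; lra.
apply/cvg_ex; exists (mkcontfun cl); apply/cvgrPdist_le => e e0.
apply: filterS (unif e e0) => f lf.
by rewrite contfun_normE; apply: sup_norm_le; [exact: ltW|exact: lf].
Qed.

HB.instance Definition _ := Uniform_isComplete.Build CK contfun_complete.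

End contfun_lmodule.

(* Main.v *)
From HB Require Import structures.
Require Import Defs.
From mathcomp Require Import all_boot all_order all_algebra.
From mathcomp Require Import all_classical all_reals all_analysis.
From mathcomp Require wochoice.
From mathcomp Require Import lra.
Import Order.TTheory GRing.Theory Num.Theory.
Import numFieldNormedType.Exports.
Local Open Scope classical_set_scope.
Local Open Scope ring_scope.

(** A nonseparable C(K) contains an uncountable 2-equilateral set as soon as
    there are uncountably many pairs (A_i, B_i) of disjoint closed subsets of K
    that are linked: for i <> j, A_i meets B_j or A_j meets B_i.  Urysohn
    functions equal to -1 on A_i and to 1 on B_i are then at mutual distance
    exactly 2 ([equilateral_of_linked]).  A 2-equilateral set is
    3/2-separated, so only the linked pairs have to be found.

    Consider boxes t = (x_t, y_t, U_t, V_t), where U_t and V_t are disjoint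
    open neighbourhoods of x_t and y_t.  Two boxes s and t are apart when
    (x_t, y_t) is not in U_s * V_s or (x_s, y_s) is not in U_t * V_t.  By
    Zorn's lemma there is a maximal family S of boxes that are pairwise apart.
    Maximality and the Hausdorff property make the rectangles U_t * V_t cover
    the complement of the diagonal of K * K.  If S were countable, the finite
    intersections of the sets U_t would form a countable base of K, and C(K)
    would be separable ([contfun_separable]).  Hence S is uncountable
    ([apart_boxes]).

    Join s and t by an edge when x_s lies in U_t and x_t lies in U_s.  Martin's
    axiom, applied to the finite cliques of a subfamily of S of cardinality
    below the continuum, yields one of two outcomes ([martin_dichotomy]), and
    both provide linked pairs.

    - There is an uncountable clique.  If s and t are joined then, as they are
      apart, y_t is not in V_s or y_s is not in V_t: the pairs
      ({y_t}, complement of V_t) are linked along the clique.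

    - The chain condition fails: there are uncountably many finite cliques such
      that the union of two of them is never a clique.  For such a clique F,
      take A_F = {x_t | t in F} and let B_F be the union of the complements of
      the sets U_t with t in F.  They are disjoint because F is a clique.  If F
      and G are two of these cliques, some s in F and t in G are not joined, so
      x_s is outside U_t or x_t is outside U_s: the pairs (A_F, B_F) are
      linked. *)

(** * Pairwise related families and cardinals *)

Definition pairwise_on {T : Type} (r : T -> T -> Prop) (S : set T) :=
  forall a b, S a -> S b -> a <> b -> r a b.

Lemma maximal_pairwise (T : Type) (I : set T) (r : T -> T -> Prop) :
  exists S : set T, [/\ S `<=` I, pairwise_on r S &
    forall t, I t -> (forall s, S s -> r s t /\ r t s) -> S t].
Proof.
pose P (S : set T) := S `<=` I /\ pairwise_on r S.
have [|S [[SI rS] Smax]] := @Zorn_bigcup T P.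
  move=> F FP Ftot; split=> [t [X FX Xt]|a b [X FX Xa] [Y FY Yb] ab].
    by have [+ _] := FP _ FX; exact.
  have [XY|YX] := Ftot _ _ FX FY.
    by have [_ +] := FP _ FY; apply=> //; exact: XY.
  by have [_ +] := FP _ FX; apply=> //; exact: YX.
exists S; split=> // t It St; apply: contrapT => nSt.
apply: (Smax (S `|` [set t])).
  split; first by move=> ? ?; left.
  by move=> /(_ t) h; apply: nSt; apply: h; right.
split=> [s [/SI//|->//]|a b [Sa|->] [Sb|->] ab].
- exact: rS.
- by have [] := St _ Sa.
- by have [] := St _ Sb.
- by [].
Qed.

(** A maximal partial bijection between A and B is total or surjective. *)
Lemma card_le_comparable (T U : Type) (A : set T) (B : set U) :
  (A #<= B)%card \/ (B #<= A)%card.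
Proof.
have [S [SAB rS Smax]] := @maximal_pairwise (T * U)%type (A `*` B)
  (fun p q => p.1 <> q.1 /\ p.2 <> q.2).
have inj1 : {in S &, injective fst}.
  move=> p q; rewrite !inE => Sp Sq pq; apply: contrapT => npq.
  by have [] := rS _ _ Sp Sq npq.
have inj2 : {in S &, injective snd}.
  move=> p q; rewrite !inE => Sp Sq pq; apply: contrapT => npq.
  by have [] := rS _ _ Sp Sq npq.
have [SA|] := pselect (A `<=` fst @` S).
  left; apply: card_le_trans (subset_card_le SA) _.
  apply: card_le_trans (card_image_le _ _) _.
  rewrite -(card_le_eql (inj_card_eq inj2)).
  by apply: subset_card_le => _ [p /SAB[_ ?] <-].
move=> /existsNP[a /not_implyP[Aa nSa]].
right; have SB : B `<=` snd @` S.
  move=> b Bb; apply: contrapT => nSb; apply: (nSa).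
  exists (a, b) => //; apply: Smax => // s Ss.
  have sa : s.1 <> a by move=> sa; apply: nSa; exists s.
  have sb : s.2 <> b by move=> sb; apply: nSb; exists s.
  by split; split=> //=; exact: nesym.
apply: card_le_trans (subset_card_le SB) _.
apply: card_le_trans (card_image_le _ _) _.
rewrite -(card_le_eql (inj_card_eq inj1)).
by apply: subset_card_le => _ [p /SAB[? _] <-].
Qed.

(** The set I is a copy of the first uncountable ordinal and C w is the initial
    segment below w.  The failure of the continuum hypothesis makes I smaller
    than the continuum; the segments C w, which are no more numerous, are
    cofinal among the countable subsets of I.  So a set that is contained in
    none of them is uncountable, and this amounts to few enough conditions for
    Martin's axiom to apply. *)
Lemma small_uncountable (nCH : ~ continuum_hypothesis) (T : Type) (S : set T) :
  ~ countable S ->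
  exists (I : set T) (C : T -> set T), [/\ I `<=` S, ~ countable I,
    card_lt I [set: set nat], forall w, I w -> countable (C w) &
    forall D, D `<=` I -> countable D -> exists2 w, I w & D `<=` C w].
Proof.
move=> ncS.
have [A [ncA Alt]] : exists A : set (set nat), ~ countable A /\
    card_lt A [set: set nat].
  move: nCH => /existsNP[A /not_implyP[ncA nA]]; exists A; split=> //.
  split; first exact: card_leT.
  by move=> le; apply: nA; rewrite card_eq_le le card_leT.
(* Whichever of A and S embeds into the other, S contains an uncountable set
   that is no larger than A. *)
have [S' [S'S ncS' S'A]] : exists S' : set T,
    [/\ S' `<=` S, ~ countable S' & (S' #<= A)%card].
  have [AS|SA] := card_le_comparable _ _ A S; last by exists S; split.
  elim/Ppointed: T => T in S ncS AS *.
    by case: ncS; rewrite emptyE; exact: countable0.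
  move: AS => /ppcard_leP[f]; exists (f @` A); split.
  - by move=> _ [a Aa <-]; exact: funS.
  - by rewrite (eq_countable (card_image f)).
  - exact: card_image_le.
elim/Peq: T => T in S ncS S' S'S ncS' S'A *.
have [R woR] := wochoice.well_ordering_principle T.
have Rmin (B : set T) : B !=set0 -> exists2 z, B z & forall x, B x -> R z x.
  move=> [b Bb]; have [|z [[]]] := woR (mem B); first by exists b; rewrite inE.
  rewrite inE => Bz zB _; exists z => // x Bx; apply: zB; exact/mem_set.
have Rtot x y : R x y \/ R y x.
  have [|z [->|->] h] := Rmin [set x; y]; first by exists x; left.
    by left; apply: h; right.
  by right; apply: h; left.
have Ranti x y : R x y -> R y x -> x = y.
  move=> xy yx.
  have [|z [_ zu]] := woR (mem [set x; y]).
    by exists x; rewrite inE; left.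
  have Rxx u : R u u by case: (Rtot u u).
  transitivity z; last apply: zu; first apply/esym/zu.
    split; first by rewrite inE; left.
    by move=> t; rewrite inE => -[->|->].
  split; first by rewrite inE; right.
  by move=> t; rewrite inE => -[->|->].
pose seg s := [set t | S' t /\ R t s].
(* If I were countable, the least point of S' outside I would have all its
   proper predecessors in I, hence countably many of them, and would belong
   to I. *)
pose I := [set s | S' s /\ countable (seg s)].
have ncI : ~ countable I.
  move=> cI; have [|s [S's nIs] smin] := Rmin (S' `\` I).
    apply: contrapT => /nonemptyPn S'I; apply: ncS'.
    apply: sub_countable cI; apply: subset_card_le => t S't.
    apply: contrapT => nIt; have : (S' `\` I) t by [].
    by rewrite S'I.
  apply: nIs; split=> //.
  have cIs : countable (I `|` [set s]).
    rewrite -bigcup2E; apply: bigcup_countable => [|[|[|n]] _] //=.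
  apply: sub_countable cIs; apply: subset_card_le => t [S't ts].
  have [It|nIt] := pselect (I t); first by left.
  by right; apply: Ranti ts _; exact: smin.
have IS' : I `<=` S' by move=> ? [].
exists I, seg; split=> //.
- exact: subset_trans S'S.
- have IA := card_le_trans (subset_card_le IS') S'A.
  case: Alt => Ac cA; split; first exact: card_le_trans Ac.
  by move=> cI; apply: cA; exact: card_le_trans IA.
- by move=> w [].
move=> D DI cD; apply: contrapT => nw; apply: ncI.
have cU : countable (\bigcup_(d in D) seg d).
  by apply: bigcup_countable => // d /DI[].
apply: sub_countable cU; apply: subset_card_le => w Iw.
apply: contrapT => nseg; apply: nw; exists w => // d Dd.
split; first exact/IS'/DI.
have [//|wd] := Rtot d w.
by case: nseg; exists d => //; split=> //; exact: IS'.
Qed.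

(** * Martin's axiom for finite cliques *)

(** Forcing conditions given by sets are ordered by reverse inclusion: a larger
    set is a stronger condition. *)
Definition condition {T : Type} (Q : set (set T)) : Type := {F : set T | Q F}.

Section condition_order.
Context {T : Type} {Q : set (set T)}.
Implicit Types p q : condition Q.

HB.instance Definition _ := gen_eqMixin (condition Q).
HB.instance Definition _ := gen_choiceMixin (condition Q).

Definition condition_le p q : bool := `[< sval q `<=` sval p >].

Lemma condition_le_refl : reflexive condition_le.
Proof. by move=> p; apply/asboolP. Qed.

Lemma condition_le_anti : antisymmetric condition_le.
Proof.
move=> [F QF] [G QG] /andP[/asboolP /= GF /asboolP /= FG].
exact/eq_exist/seteqP.
Qed.

Lemma condition_le_trans : transitive condition_le.
Proof.
move=> q p r /asboolP qp /asboolP rq; apply/asboolP.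
exact: subset_trans rq qp.
Qed.

HB.instance Definition _ := Order.Le_isPOrder.Build (Order.Disp tt tt)
  (condition Q) condition_le_refl condition_le_anti condition_le_trans.

Lemma condition_leE p q : (p <= q)%O <-> sval q `<=` sval p.
Proof. by split=> [/asboolP|] // h; exact/asboolP. Qed.

End condition_order.

Definition clique {T : Type} (e : T -> T -> Prop) (F : set T) :=
  forall a b, F a -> F b -> e a b.

Definition clash {T : Type} (e : T -> T -> Prop) (F G : set T) :=
  ~ clique e (F `|` G).

Definition finite_clique {T : Type} (e : T -> T -> Prop) (I : set T) :
    set (set T) :=
  [set F | [/\ F `<=` I, finite_set F & clique e F]].

Section finite_cliques.
Context {T : Type} {e : T -> T -> Prop} {I : set T} (C : T -> set T)
  (ee : forall a, I a -> e a a) (ncI : ~ countable I)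
  (cC : forall w, I w -> countable (C w))
  (ccc : forall FF : set (set T),
    FF `<=` finite_clique e I -> pairwise_on (clash e) FF -> countable FF).

(** Below a suitable condition F0, every condition can be extended outside any
    given C w; this is the density that keeps a generic clique uncountable.
    Otherwise each singleton {a} has an extension p a such that all extensions
    of p a stay inside one countable set C w.  A maximal family of indices a for
    which the cliques p a pairwise clash is countable by the chain condition;
    then some c in I avoids all the corresponding sets C w, so that p c, which
    contains c, clashes with every member of the family. *)
Lemma forcing_uncountable : exists2 F0, finite_clique e I F0 &
  forall w F, I w -> finite_clique e I F -> F0 `<=` F ->
    exists G, [/\ finite_clique e I G, F `<=` G & ~ G `<=` C w].
Proof.
apply: contrapT => /forall2NP H.
have /choice[pw pwP] (a : T) : exists wF : T * set T, I a ->
    [/\ I wF.1, finite_clique e I wF.2, wF.2 a &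
      forall G, finite_clique e I G -> wF.2 `<=` G -> G `<=` C wF.1].
  have [Ia|nIa] := pselect (I a); last by exists (a, set0).
  have fa : finite_clique e I [set a].
    by split=> [_ ->||_ _ -> ->] //; exact: ee.
  have [//|/existsNP[w /existsNP[F]]] := H [set a].
  move=> /not_implyP[Iw /not_implyP[fF /not_implyP[aF nG]]].
  exists (w, F) => _; split=> //=; first exact: aF.
  move=> G fG FG; apply: contrapT => nGC; apply: nG; exists G; split=> //.
pose p a := (pw a).2.
have pP a : I a -> finite_clique e I (p a) /\ p a a.
  by move=> /pwP[].
have [S [SI rS Smax]] := maximal_pairwise _ I (fun a b => clash e (p a) (p b)).
have cS : countable S.
  have inj : {in S &, injective p}.
    move=> a b; rewrite !inE => Sa Sb pab; apply: contrapT => nab.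
    apply: (rS _ _ Sa Sb nab); rewrite pab setUid.
    by have [[]] := pP _ (SI _ Sb).
  rewrite -(eq_countable (inj_card_eq inj)); apply: ccc.
    by move=> _ [a /SI Ia <-]; have [] := pP a Ia.
  move=> _ _ [a Sa <-] [b Sb <-] ab; apply: rS => //.
  by move=> eab; apply: ab; rewrite eab.
apply: ncI.
have cU : countable (\bigcup_(a in S) C (pw a).1).
  by apply: bigcup_countable => // a /SI /pwP[Iw _ _ _]; exact: cC.
apply: sub_countable cU; apply: subset_card_le => c Ic.
apply: contrapT => nc.
have [[pcI fpc clpc] pcc] := pP c Ic.
have nbad s : S s -> clash e (p s) (p c).
  move=> Ss cl; apply: nc; exists s => //.
  have [Iw [psI fps _] _ Gs] := pwP _ (SI _ Ss).
  apply: (Gs (p s `|` p c)); [|by move=> ? ?; left|by right].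
  by split=> //; [rewrite subUset|rewrite finite_setU].
have Sc : S c.
  apply: Smax => // s Ss; split; first exact: nbad.
  by rewrite /clash setUC; exact: nbad.
apply: nc; exists c => //.
have [_ fc cc Gc] := pwP _ Ic.
exact: (Gc (p c)).
Qed.

(** Martin's axiom is applied to the finite cliques extending the clique F0 of
    [forcing_uncountable]; the union of a generic filter is the clique X.  The
    dense sets say that a condition is not contained in C w, so X is contained
    in no C w and cannot be countable. *)
Lemma uncountable_clique_of_ccc :
  martin_axiom -> card_lt I [set: set nat] ->
  (forall D, D `<=` I -> countable D -> exists2 w, I w & D `<=` C w) ->
  exists X : set T, [/\ X `<=` I, ~ countable X & clique e X].
Proof.
move=> MA smallI cofC; have [F0 fF0 forc] := forcing_uncountable.
pose Q := [set F | finite_clique e I F /\ F0 `<=` F].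
pose P := condition Q.
pose Dn w : set P := [set p | ~ sval p `<=` C w].
have QF0 : Q F0 by split.
have [||||G [_ Gup Gdir] Gmeet] := MA _ P (Dn @` I).
- by exists (exist _ F0 QF0).
- move=> A antiA.
  have inj : {in A &, injective (sval : P -> set T)}.
    by move=> [F QF] [G QG] _ _ /= FG; exact: eq_exist.
  rewrite -(eq_countable (inj_card_eq inj)); apply: ccc.
    by move=> _ [p _ <-]; have [] := svalP p.
  move=> _ _ [p Ap <-] [q Aq <-] pq cl.
  apply: (antiA p q) => //; first by move=> epq; apply: pq; rewrite epq.
  have [[pI fp _] F0p] := svalP p; have [[qI fq _] F0q] := svalP q.
  have Qpq : Q (sval p `|` sval q).
    split; last by move=> ? /F0p; left.
    by split=> //; [rewrite subUset|rewrite finite_setU].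
  exists (exist _ _ Qpq).
  by split; apply/condition_leE => ? ?; [left|right].
- case: smallI => IA AI; split.
    exact: card_le_trans (card_image_le _ _) IA.
  by move=> h; apply: AI; exact: card_le_trans h (card_image_le _ _).
- move=> _ [w Iw <-] p.
  have [fp F0p] := svalP p.
  have [G [fG pG nG]] := forc w (sval p) Iw fp F0p.
  have QG : Q G by split=> //; exact: subset_trans pG.
  by exists (exist _ G QG) => //; apply/condition_leE.
pose X := \bigcup_(p in G) sval p.
have XI : X `<=` I by move=> a [p _ pa]; have [[+ _ _] _] := svalP p; exact.
exists X; split=> //.
  move=> cX; have [w Iw XC] := cofC X XI cX.
  have [p [Gp]] := Gmeet _ (imageP Dn Iw).
  by apply; move=> a pa; apply: XC; exists p.
move=> a b [p Gp pa] [q Gq qb].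
have [r [_ /condition_leE rp /condition_leE rq]] := Gdir _ _ Gp Gq.
by have [[_ _ clr] _] := svalP r; apply: clr; [exact: rp|exact: rq].
Qed.

End finite_cliques.

(** The alternative is whether the finite cliques of a sufficiently small
    uncountable subset of S satisfy the chain condition. *)
Lemma martin_dichotomy (MA : martin_axiom) (nCH : ~ continuum_hypothesis)
    (T : Type) (e : T -> T -> Prop) (S : set T) :
  (forall a, S a -> e a a) -> ~ countable S ->
  (exists X, [/\ X `<=` S, ~ countable X & clique e X]) \/
  (exists FF, [/\ FF `<=` finite_clique e S, ~ countable FF &
    pairwise_on (clash e) FF]).
Proof.
move=> ee ncS.
have [I [C [IS ncI Ilt cC cofC]]] := small_uncountable nCH _ S ncS.
have [ccc|] := pselect (forall FF : set (set T),
  FF `<=` finite_clique e I -> pairwise_on (clash e) FF -> countable FF).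
  left; have eI a : I a -> e a a by move=> /IS; exact: ee.
  have [X [XI ncX clX]] :=
    uncountable_clique_of_ccc C eI ncI cC ccc MA Ilt cofC.
  by exists X; split=> //; exact: subset_trans IS.
move=> /existsNP[FF /not_implyP[FFI /not_implyP[FFclash ncFF]]].
right; exists FF; split=> // F /FFI[FI fF clF].
by split=> //; exact: subset_trans IS.
Qed.

(** * Separability of C(K) *)

Lemma compact_finite_cover (K : topologicalType) (A : set K) (I : choiceType)
    (D : set I) (f : I -> set K) :
  compact A -> (forall i, D i -> open (f i)) ->
  (forall x, A x -> exists2 i, D i & f i x) ->
  exists2 s : seq I, (forall i, i \in s -> D i) &
    forall x, A x -> exists2 i, i \in s & f i x.
Proof.
move=> cA of_ Af.
have [[x0 Ax0]|A0] := pselect (A !=set0); last first.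
  by exists [::] => // x Ax; case: A0; exists x.
(* A point of A serves as the base point of K. *)
pose Kp : ptopologicalType := HB.pack K (isPointed.Build K x0).
have : @compact Kp A := cA.
rewrite compact_cover => /(_ I D f of_)[|s sD sA].
  by move=> x /Af[i Di fi]; exists i.
exists (finmap.enum_fset s) => [i /sD|x /sA[i si fi]]; first by rewrite inE.
by exists i.
Qed.

Section separability.
Context {R : realType} {K : topologicalType} (cK : compact [set: K])
  {U V : nat -> set K} (oU : forall n, open (U n)) (oV : forall n, open (V n))
  (UV0 : forall n x, U n x -> V n x -> False)
  (UVsep : forall x y, x <> y -> exists n, U n x /\ V n y).

Definition finI_of (l : seq nat) : set K :=
  [set x | forall n, n \in l -> U n x].

Lemma finI_of_open l : open (finI_of l).
Proof.
elim: l => [|n l IH].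
  by rewrite (_ : finI_of [::] = setT); [exact: openT|apply/seteqP; split].
rewrite (_ : finI_of (n :: l) = U n `&` finI_of l); first exact: openI.
apply/seteqP; split=> [x h|x [Ux h] m].
  by split=> [|m ml]; apply: h; rewrite inE ?eqxx ?ml ?orbT.
by rewrite inE => /predU1P[->//|]; exact: h.
Qed.

(** Each point z outside O is in some V n with x in U n; finitely many such V n
    cover the compact complement of O, and the corresponding U n avoid them. *)
Lemma finI_of_basis (O : set K) x : open O -> O x ->
  exists2 l, finI_of l x & finI_of l `<=` O.
Proof.
move=> oO Ox.
have cO : compact (~` O).
  by apply: subclosed_compact cK _ => //; rewrite closedC.
have [| |s sU scov] := @compact_finite_cover K _ _ [set n | U n x] V cO.
- by move=> n _; exact: oV.
- move=> y nOy; have [n [Ux Vy]] : exists n, U n x /\ V n y.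
    by apply: UVsep => xy; apply: nOy; rewrite -xy.
  by exists n.
exists s => // z sz; apply: contrapT => /scov[n ns Vz].
exact: UV0 (sz n ns) Vz.
Qed.

(** A code (e, l) lists finitely many basic sets covering K together with a
    rational number for each, and f stays within e of that number on the basic
    set.  Functions with a common code are 2e-close, and there are only
    countably many codes: this is what turns a countable base of K into a
    countable dense subset of C(K). *)
Definition approximates (c : rat * seq (seq nat * rat)) (f : contfun R cK) :=
  (forall x, exists2 p, p \in c.2 & finI_of p.1 x) /\
  (forall p, p \in c.2 -> forall x, finI_of p.1 x ->
     `|f x - ratr p.2| <= ratr c.1).

Lemma approximates_dist c f g :
  approximates c f -> approximates c g -> 0 <= ratr c.1 :> R ->
  `|f - g| <= ratr c.1 + ratr c.1.
Proof.
move=> [cov cf] [_ cg] c0; rewrite contfun_normE; apply: sup_norm_le => [|x].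
  exact: addr_ge0.
rewrite contfunDE contfunNE; have [p pc px] := cov x.
apply: le_trans (ler_distD (ratr p.2) _ _) _; apply: lerD; first exact: cf.
by rewrite distrC; exact: cg.
Qed.

Lemma ex_approximates (e : rat) f : 0 < ratr e :> R ->
  exists l, approximates (e, l) f.
Proof.
move=> e0.
pose D := [set p : seq nat * rat |
  forall x, finI_of p.1 x -> `|f x - ratr p.2| <= ratr e].
have [| |l lD lcov] :=
  @compact_finite_cover K setT _ D (fun p => finI_of p.1) cK.
- by move=> p _; exact: finI_of_open.
- move=> x _.
  have [q] : exists q : rat, ratr q \in `]f x - ratr e, f x + ratr e[.
    by apply: rat_in_itvoo; rewrite ltrBlDr -addrA ltrDl addr_gt0.
  rewrite in_itv/= => /andP[q1 q2].
  have oO : open (f @^-1` ball (ratr q : R) (ratr e)).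
    apply: open_comp; last exact: ball_open.
    by move=> z _; exact: contfun_continuous.
  have [|l lx lO] := finI_of_basis _ x oO.
    by rewrite /= -ball_normE /= ltr_norml; lra.
  exists (l, q) => //= z /lO; rewrite /= -ball_normE /= => /ltW.
  by rewrite distrC.
by exists l; split=> // x; have [p pl px] := lcov x I; exists p.
Qed.

(** The sequences U and V separate the points of K, which makes the finite
    intersections of the U n a countable base. *)
Lemma contfun_separable : separable (contfun R cK).
Proof.
have /choice[g gP] c :
    exists g, (exists f, approximates c f) -> approximates c g.
  have [[f cf]|nf] := pselect (exists f, approximates c f); first by exists f.
  by exists (0 : contfun R cK) => /nf.
exists (range g).
  exact: sub_countable (card_image_le _ _) (countableP _).
move=> O [f Of] oO; have /nbhs_ballP[e /= e0 eO] : nbhs f O.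
  exact: open_nbhs_nbhs.
have [q] : exists q : rat, ratr q \in `]0, e / 2[.
  by apply: rat_in_itvoo; rewrite divr_gt0.
rewrite in_itv/= => /andP[q0 qe].
have [l fl] := ex_approximates q f q0.
exists (g (q, l)); split; last by exists (q, l).
apply: eO; rewrite -ball_normE /=.
apply: le_lt_trans (approximates_dist (q, l) _ _ fl _ _) _ => /=.
- by apply: gP; exists f.
- exact: ltW.
by rewrite [e]splitr ltrD.
Qed.

End separability.

(** * Linked pairs of closed sets *)

Lemma equilateral_of_linked (R : realType) (K : topologicalType)
    (cK : compact [set: K]) (hK : hausdorff_space K) (I : Type)
    (S : set I) (A B : I -> set K) :
  ~ countable S ->
  (forall i, S i -> [/\ closed (A i), closed (B i) & A i `&` B i = set0]) ->
  pairwise_on (fun i j => (A i `&` B j) !=set0 \/ (A j `&` B i) !=set0) S ->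
  exists E : set (contfun R cK),
    [/\ E `<=` unit_ball (contfun R cK), ~ countable E & r_equilateral 2 E].
Proof.
move=> ncS clS link.
have nK := compact_normal hK cK.
have /choice[f fP] i : exists f : contfun R cK, S i ->
    [/\ forall x, A i x -> f x = -1, forall x, B i x -> f x = 1 &
        forall x, -1 <= f x <= 1].
  have [Si|nSi] := pselect (S i); last by exists 0.
  have [cA cB AB0] := clS i Si.
  have lt11 : -1 < 1 :> R by rewrite gtrN.
  have [f [cf fA fB f11]] := urysohn_ext_itv nK cA cB AB0 lt11.
  exists (mkcontfun cf) => _; split=> x.
  - by move=> Ax; apply: fA; exists x.
  - by move=> Bx; apply: fB; exists x.
  - by have := f11 (f x); rewrite /= in_itv/=; apply; exists x.
have le2 i j : S i -> S j -> `|f i - f j| <= 2.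
  move=> /fP[_ _ fi] /fP[_ _ fj]; apply: sup_norm_le => // x.
  rewrite contfunDE contfunNE; have := fi x; have := fj x.
  by rewrite ler_norml; lra.
have eq2 i j : S i -> S j -> i <> j -> `|f i - f j| = 2.
  move=> Si Sj ij; apply/eqP; rewrite eq_le le2//=.
  have [fiA fiB _] := fP i Si; have [fjA fjB _] := fP j Sj.
  have [[x [Ax Bx]]|[x [Ax Bx]]] := link i j Si Sj ij.
    apply: le_trans (sup_norm_ub _ x).
    rewrite contfunDE contfunNE fiA// fjB//.
    by rewrite ler_normr; apply/orP; right; lra.
  apply: le_trans (sup_norm_ub _ x).
  rewrite contfunDE contfunNE fiB// fjA//.
  by rewrite ler_normr; apply/orP; left; lra.
exists (f @` S); split.
- move=> _ [i /fP[_ _ fi] <-]; apply: sup_norm_le => // x.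
  by rewrite ler_norml.
- have inj : {in S &, injective f}.
    move=> i j; rewrite !inE => Si Sj fij; apply: contrapT => ij.
    have := eq2 i j Si Sj ij; rewrite fij subrr normr0 => /esym/eqP.
    by rewrite pnatr_eq0.
  by rewrite (eq_countable (inj_card_eq inj)).
- move=> _ _ [i Si <-] [j Sj <-] fij; apply: eq2 => // ij.
  by apply: fij; rewrite ij.
Qed.

Lemma separated_of_equilateral (R : realType) (V : completeNormedModType R)
    (r s : R) (E : set V) : s < r -> r_equilateral r E -> r_separated s E.
Proof. by move=> sr eqE v w Ev Ew vw; rewrite eqE. Qed.

(** * Boxes that are pairwise apart *)

Record box (K : Type) := Box {
  ptl : K; ptr : K; sidel : set K; sider : set K }.
Arguments ptl {K}. Arguments ptr {K}. Arguments sidel {K}. Arguments sider {K}.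

Definition separating_box (K : topologicalType) (t : box K) : Prop :=
  [/\ open (sidel t), open (sider t), forall x, sidel t x -> sider t x -> False,
      sidel t (ptl t) & sider t (ptr t)].

Definition in_box {K : Type} (t : box K) (x y : K) := sidel t x /\ sider t y.

Definition apart {K : Type} (s t : box K) :=
  ~ in_box s (ptl t) (ptr t) \/ ~ in_box t (ptl s) (ptr s).

(** A maximal family of boxes that are pairwise apart is uncountable: an
    off-diagonal point (x, y) that none of its rectangles contains would lie in
    a separating box apart from all of them. *)
Lemma apart_boxes (R : realType) (K : topologicalType)
    (cK : compact [set: K]) (hK : hausdorff_space K) :
  ~ separable (contfun R cK) ->
  exists S : set (box K), [/\ ~ countable S, S `<=` @separating_box K &
    pairwise_on apart S].
Proof.
move=> nsep.
have [S [Sbox Sapart Smax]] := maximal_pairwise _ (@separating_box K) apart.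
exists S; split=> // cS; apply: nsep.
have Scov x y : x <> y -> exists2 t, S t & in_box t x y.
  move=> xy; apply: contrapT => ncov.
  have [[A B]/= [Ax By] [oA oB /eqP AB]] : exists2 AB : set K * set K,
      (x \in AB.1 /\ y \in AB.2) &
      [/\ open AB.1, open AB.2 & AB.1 `&` AB.2 == set0].
    by move: hK; rewrite open_hausdorff; apply; exact/eqP.
  rewrite !inE in Ax By.
  apply: (ncov); exists (Box _ x y A B) => //.
  apply: Smax.
    split=> // z Az Bz; suff : set0 z by [].
    by rewrite -AB.
  move=> s Ss; split; [left|right]; move=> sxy; apply: (ncov); by exists s.
(* An injective numbering c of S turns its boxes into sequences; the unions
   below have at most one term. *)
have /countable_injP[c injc] := cS.
pose U n := \bigcup_(t in S `&` c @^-1` [set n]) sidel t.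
pose V n := \bigcup_(t in S `&` c @^-1` [set n]) sider t.
apply: (@contfun_separable R K cK U V).
- by move=> n; apply: bigcup_open => t [/Sbox[]].
- by move=> n; apply: bigcup_open => t [/Sbox[]].
- move=> n x [s [Ss sn] sx] [t [St tn] tx].
  have st : s = t by apply: injc; rewrite ?inE//= sn tn.
  by have [_ _ + _ _] := Sbox _ St; apply; [rewrite -st; exact: sx|].
- by move=> x y /Scov[t St [tx ty]]; exists (c t); split; exists t.
Qed.

Lemma closed_finite_bigcup (K : topologicalType) (I : Type) (A : set I)
    (F : I -> set K) :
  finite_set A -> (forall i, A i -> closed (F i)) ->
  closed (\bigcup_(i in A) F i).
Proof. by elim/Pchoice: I => I in A F *; exact: closed_bigcup. Qed.

(** In a clique of the graph e, apartness of s and t can only come from the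
    right sides: y_t is outside V_s or y_s is outside V_t.  When two finite
    cliques clash, the missing edge puts some left point x_s of one of them
    outside the left side U_t of a box of the other.  So both outcomes of
    [martin_dichotomy] link closed pairs. *)
Lemma equilateral_of_apart_boxes (MA : martin_axiom)
    (nCH : ~ continuum_hypothesis) (R : realType) (K : topologicalType)
    (cK : compact [set: K]) (hK : hausdorff_space K) (S : set (box K)) :
  ~ countable S -> S `<=` separating_box K -> pairwise_on apart S ->
  exists E : set (contfun R cK),
    [/\ E `<=` unit_ball (contfun R cK), ~ countable E & r_equilateral 2 E].
Proof.
move=> ncS Sbox Sapart.
have cl1 := accessible_finite_set_closed.1 (hausdorff_accessible hK).
pose e (s t : box K) := sidel s (ptl t) /\ sidel t (ptl s).
have ee s : S s -> e s s by move=> /Sbox[].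
have [[X [XS ncX clX]]|[FF [FFcl ncFF FFclash]]] :=
    martin_dichotomy MA nCH _ e S ee ncS.
  apply: (equilateral_of_linked _ _ cK hK _ X (fun t => [set ptr t])
    (fun t => ~` sider t) ncX) => [t /XS/Sbox[ot1 ot2 _ _ tt]|s t Xs Xt st].
    split; [exact: cl1|by rewrite closedC|].
    by apply/seteqP; split=> // z [->].
  have [st1 ts1] := clX _ _ Xs Xt.
  have [nst|nts] := Sapart s t (XS _ Xs) (XS _ Xt) st.
  - by right; exists (ptr t); split=> // st2; apply: nst.
  - by left; exists (ptr s); split=> // ts2; apply: nts.
apply: (equilateral_of_linked _ _ cK hK _ FF (fun F => ptl @` F)
  (fun F => \bigcup_(t in F) ~` sidel t) ncFF)
  => [F /FFcl[FI fF clF]|F G FFF FFG FG].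
  split.
  - by apply: cl1; exact: finite_image.
  - apply: closed_finite_bigcup => // t /FI/Sbox[ot _ _ _ _].
    by rewrite closedC.
  - apply/seteqP; split=> // z [[s Fs <-] [t Ft]]; apply.
    by have [] := clF _ _ Ft Fs.
have [FI fF clF] := FFcl F FFF; have [GI fG clG] := FFcl G FFG.
apply: contrapT => /not_orP[nFG nGF]; apply: (FFclash F G FFF FFG FG).
have sub (F1 G1 : set (box K)) :
    ~ (((ptl @` F1) `&` (\bigcup_(t in G1) ~` sidel t)) !=set0) ->
    forall s t, F1 s -> G1 t -> sidel t (ptl s).
  move=> h s t Fs Gt; apply: contrapT => nts; apply: h.
  by exists (ptl s); split; [exists s|exists t].
move=> s t [Fs|Gs] [Ft|Gt].
- exact: clF.
- by split; [exact: (sub _ _ nGF)|exact: (sub _ _ nFG)].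
- by split; [exact: (sub _ _ nFG)|exact: (sub _ _ nGF)].
- exact: clG.
Qed.

Theorem theorem5p1 (MA : martin_axiom) (nCH : ~ continuum_hypothesis)
    (R : realType) (K : topologicalType) (cK : compact [set: K])
    (hK : hausdorff_space K) (nsep : ~ separable (contfun R cK)) :
  (exists A : set (contfun R cK),
    [/\ A `<=` unit_ball (contfun R cK), ~ countable A & r_equilateral 2 A]) /\
  (exists2 e : R, 0 < e & exists A : set (contfun R cK),
    [/\ A `<=` unit_ball (contfun R cK), ~ countable A & r_separated (1 + e) A]).
Proof.
suff [E [E1 ncE eqE]] : exists A : set (contfun R cK),
    [/\ A `<=` unit_ball (contfun R cK), ~ countable A & r_equilateral 2 A].
  split; first by exists E.
  exists 2^-1; first by rewrite invr_gt0.
  exists E; split=> //; apply: separated_of_equilateral eqE.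
  by lra.
have [S [ncS Sbox Sapart]] := apart_boxes _ _ _ hK nsep.
exact: (equilateral_of_apart_boxes MA nCH R K cK hK S).
Qed.
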